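(* Let $X\subset\mathbb{R}$ be a nonempty compact polytope (i.e. a single point or a closed bounded interval) with $n_v\in\{1,2\}$ vertices, let $n_f\in\mathbb{N}\cup\{\infty\}$ be a known upper bound on the number of vertices, $n_f\ge n_v$, and let $\mathsf{D}:\mathbb{R}\to\mathbb{R}$ be the oracle $\mathsf{D}(d)=\max_{v\in X} v d$. If $n_f=1$, then $X$ can be reconstructed from a single oracle evaluation, namely $X=\{\mathsf{D}(1)\}$. Otherwise $X$ can be reconstructed from two oracle evaluations, $\mathsf{D}(1)$ and $\mathsf{D}(-1)$: if $\mathsf{D}(1)=-\mathsf{D}(-1)$ then $n_v=1$ and $X=\{\mathsf{D}(1)\}$, and otherwise $n_v=2$ and $X=\mathrm{conv}\{\mathsf{D}(1),-\mathsf{D}(-1)\}$.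
   Context: The setting abstracts reconstruction of a polyhedral subdifferential: $X$ plays the role of $\partial f(\bar x)$ and $\mathsf{D}(d)$ the role of the directional derivative $df(\bar x;d)=\max_{v\in X}v^\top d$. An oracle evaluation (call) is one evaluation of $\mathsf{D}$ at a chosen direction. The value $n_f=\infty$ means no upper bound is known. *)

(* Defs.v *)
From mathcomp Require Import all_boot all_order all_algebra finmap lra.
From mathcomp Require Import all_classical all_reals all_analysis.

Set Implicit Arguments.
Unset Strict Implicit.
Unset Printing Implicit Defensive.

Import Order.TTheory GRing.Theory Num.Theory.
Import numFieldNormedType.Exports.

Local Open Scope classical_set_scope.
Local Open Scope ring_scope.

Definition conv_hull (R : realType) (A : set R) : set R :=
  smallest (@convex_set R R^o) A.

Definition polytope (R : realType) (X : set R) : Prop :=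
  exists2 A : set R, finite_set A & X = conv_hull A.

(* Extreme points. *)
Definition vertices (R : realType) (X : set R) : set R :=
  [set v | X v /\ forall x y t : R, X x -> X y -> 0 < t < 1 ->
                   v = t * x + (1 - t) * y -> x = v /\ y = v].

(* fset_set returns the empty set on an infinite set; on a polytope this does
   not occur, see finite_vertices. *)
Definition nb_vertices (R : realType) (X : set R) : nat :=
  #|` fset_set (vertices X)|.

(* Upper bounds in {0, 1, 2, ...} together with infinity, encoded by None. *)
Definition vertex_bound (n : nat) (nf : option nat) : Prop :=
  if nf is Some m then (n <= m)%N else True.

Definition is_max (R : realType) (A : set R) (m : R) : Prop :=
  A m /\ ubound A m.

Definition is_oracle (R : realType) (X : set R) (D : R -> R) : Prop :=
  forall d, is_max [set v * d | v in X] (D d).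

(* An adaptive procedure that learns about an unknown D : R -> R only by asking
   for its values, each next step depending on the answers received so far. *)
Inductive procedure (R A : Type) : Type :=
| Return of A
| Ask of R & (R -> procedure R A).

Arguments Return {R A}.
Arguments Ask {R A}.

Fixpoint result (R A : Type) (p : procedure R A) (D : R -> R) : A :=
  match p with
  | Return a => a
  | Ask d k => result (k (D d)) D
  end.

(* The directions at which D is evaluated, in order. *)
Fixpoint queries (R A : Type) (p : procedure R A) (D : R -> R) : seq R :=
  match p with
  | Return _ => [::]
  | Ask d k => d :: queries (k (D d)) D
  end.

Lemma conv_hull_convex (R : realType) (A : set R) :
  @convex_set R R^o (conv_hull A).
Proof.
move=> x y t; rewrite !inE => Ax Ay B [cB AB].
by have := cB x y t; rewrite !inE; apply; [exact: Ax | exact: Ay].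
Qed.

Lemma finite_vertices (R : realType) (X : set R) :
  polytope X -> finite_set (vertices X).
Proof.
move=> [A finA XA]; apply: sub_finite_set finA => v [Xv extv].
apply: contrapT => nAv.
suff : (X `\ v) v by case=> _; apply.
have cX : @convex_set R R^o X by rewrite XA; exact: conv_hull_convex.
have : conv_hull A v by rewrite -XA.
apply; split; last first.
  move=> a Aa; split; last by move=> /= av; apply: nAv; rewrite -av.
  by rewrite XA => B [_]; apply.
apply/convex_setW => x y; rewrite !inE => -[Xx xv] [Xy yv] t t0 t1.
rewrite inE; split; first by have := cX x y t; rewrite !inE; apply.
move=> /esym vE; apply: xv.
by have [] := extv x y t%:num Xx Xy _ vE; first by rewrite t0.
Qed.

Lemma oracle_exists (R : realType) (X : set R) :
  X !=set0 -> compact X -> exists D, is_oracle X D.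
Proof.
move=> X0 cX.
suff /choice[D DP] : forall d, exists m, is_max [set v * d | v in X] m.
  by exists D.
move=> d; have [|c Xc cmax] := compact_EVT_max (f := fun v : R => v * d) X0 cX.
  by apply: continuous_subspaceT => v; exact: mulrr_continuous.
exists (c * d); split; first by exists c => //; rewrite inE in Xc.
by move=> _ [v Xv <-]; apply: cmax; rewrite inE.
Qed.

(* Main.v *)
Require Import Defs.
From mathcomp Require Import all_boot all_order all_algebra finmap ring lra.
From mathcomp Require Import all_classical all_reals all_analysis.

Set Implicit Arguments.
Unset Strict Implicit.
Unset Printing Implicit Defensive.

Import Order.TTheory GRing.Theory Num.Theory.
Import numFieldNormedType.Exports.

Local Open Scope classical_set_scope.
Local Open Scope ring_scope.

(** A bounded convex subset of the line that attains its infimum m and its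
    supremum M is the segment [m, M] (convex_itv), and the oracle returns
    exactly these two numbers: M = D(1) and m = - D(-1), because maximizing
    v * (-1) over X is minimizing v over X (oracle_max, oracle_min,
    oracle_itv).  So after the two answers X is known, whatever the bound on
    the number of vertices.

    The extreme points of [m, M] are m and M (vertices_itv), so the number of
    vertices is 1 when m = M and 2 when m < M (nb_vertices_itv1,
    nb_vertices_itv).  This gives the case distinction on D(1) = - D(-1).  It
    also shows that knowing in advance that there is at most one vertex forces
    m = M, in which case the first answer alone determines X = {M}. *)

Lemma itv_convex (R : realType) (m M : R) : @convex_set R R^o `[m, M]%classic.
Proof.
move=> x y t; rewrite !inE /= !in_itv /= => /andP[mx xM] /andP[my yM].
have -> : conv t (x : convex_lmodType R^o) y = t%:num * x + (1 - t%:num) * y.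
  by [].
have [t0 t1] : 0 <= t%:num /\ t%:num <= 1 by split; [exact: ge0 | exact: le1].
by apply/andP; split; nra.
Qed.

(** The point v between m and M is the convex combination of M and m with
    weights (v - m) / (M - m) and (M - v) / (M - m), so convexity puts it in
    X. *)
Lemma convex_itv (R : realType) (X : set R) (m M : R) :
  @convex_set R R^o X -> X m -> X M -> (forall v, X v -> m <= v <= M) ->
  X = `[m, M]%classic.
Proof.
move=> cX Xm XM XmM; apply/seteqP; split=> v /=.
  by move=> /XmM; rewrite in_itv.
rewrite in_itv /= => /andP[mv vM].
(* The weights have no meaning when m = M. *)
have [mM|] := ltP m M; last first.
  by move=> Mm; have -> : v = m by lra.
have w01 : 0 <= (v - m) / (M - m) <= 1.
  by rewrite divr_ge0 ?ler_pdivrMr; lra.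
have /andP[w0 w1] := w01.
have := cX M m (Itv01 w0 w1); rewrite !inE => /(_ XM Xm).
suff -> : conv (Itv01 w0 w1) (M : convex_lmodType R^o) m = v by [].
rewrite -[LHS]/((v - m) / (M - m) * M + (1 - (v - m) / (M - m)) * m).
by field; lra.
Qed.

Lemma conv_hull2 (R : realType) (m M : R) :
  m <= M -> conv_hull [set M; m] = `[m, M]%classic.
Proof.
move=> mM; apply: convex_itv; first exact: conv_hull_convex.
- by move=> B [_]; apply; right.
- by move=> B [_]; apply; left.
move=> v /(_ `[m, M]%classic); rewrite /= in_itv /=; apply; split.
  exact: itv_convex.
by move=> x [] -> /=; rewrite in_itv /= lexx mM.
Qed.

Lemma polytope_convex (R : realType) (X : set R) :
  polytope X -> @convex_set R R^o X.
Proof. by move=> [A _ ->]; exact: conv_hull_convex. Qed.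

(** An interior point is a proper convex combination of the two endpoints,
    hence not extreme.  An endpoint is extreme because an average with positive
    weights of points on one side of it equals it only if both points do. *)
Lemma vertices_itv (R : realType) (m M : R) :
  m <= M -> vertices `[m, M]%classic = [set m; M].
Proof.
move=> mM; apply/seteqP; split=> v /=.
  move=> [] /=; rewrite in_itv /= => /andP[mv vM] extv.
  have [->|vm] := eqVneq v m; first by left.
  have [->|vM'] := eqVneq v M; first by right.
  have {mv vm}mv : m < v by rewrite lt_neqAle eq_sym vm.
  have {vM vM'}vM : v < M by rewrite lt_neqAle vM'.
  have [||||->] := extv m M ((M - v) / (M - m)); last by left.
  - by rewrite /= in_itv /= lexx mM.
  - by rewrite /= in_itv /= lexx mM.
  - by rewrite divr_gt0 ?ltr_pdivrMr; lra.
  - by field; lra.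
by case=> ->; (split; first by rewrite /= in_itv /= lexx mM);
  move=> x y t /=; rewrite !in_itv /= => /andP[mx xM] /andP[my yM]
    /andP[t0 t1] vE; split; nra.
Qed.

Lemma nb_vertices_itv1 (R : realType) (m : R) :
  nb_vertices `[m, m]%classic = 1%N.
Proof.
by rewrite /nb_vertices vertices_itv// setUid fset_set1 cardfs1.
Qed.

Lemma nb_vertices_itv (R : realType) (m M : R) :
  m < M -> nb_vertices `[m, M]%classic = 2%N.
Proof.
move=> mM; rewrite /nb_vertices vertices_itv ?ltW// fset_setU// !fset_set1.
by rewrite cardfs2 lt_eqF.
Qed.

Lemma oracle_max (R : realType) (X : set R) (D : R -> R) :
  is_oracle X D -> is_max X (D 1).
Proof.
move=> /(_ 1) [[x Xx xD] ubD]; split; first by rewrite -xD mulr1.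
by move=> v Xv; apply: ubD; exists v; rewrite ?mulr1.
Qed.

Lemma oracle_min (R : realType) (X : set R) (D : R -> R) :
  is_oracle X D -> X (- D (-1)) /\ lbound X (- D (-1)).
Proof.
move=> /(_ (-1)) [[x Xx xD] ubD]; split.
  by rewrite -xD mulrN1 opprK.
by move=> v Xv; rewrite lerNl; apply: ubD; exists v; rewrite ?mulrN1.
Qed.

Lemma oracle_le (R : realType) (X : set R) (D : R -> R) :
  is_oracle X D -> - D (-1) <= D 1.
Proof.
by move=> XD; have [_] := oracle_max XD; apply; have [] := oracle_min XD.
Qed.

Lemma oracle_itv (R : realType) (X : set R) (D : R -> R) :
  polytope X -> is_oracle X D -> X = `[- D (-1), D 1]%classic.
Proof.
move=> /polytope_convex cX XD.
have [XM ubM] := oracle_max XD; have [Xm lbm] := oracle_min XD.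
by apply: convex_itv => // v Xv; rewrite lbm//=; exact: ubM.
Qed.

Theorem mainTheorem1 (R : realType) (nf : option nat) :
  (nf = Some 1%N ->
   exists p : procedure R (set R),
   forall (X : set R) (D : R -> R),
     X !=set0 -> compact X -> polytope X ->
     vertex_bound (nb_vertices X) nf -> is_oracle X D ->
     [/\ queries p D = [:: 1], result p D = X & X = [set D 1] ])
  /\
  (nf <> Some 1%N ->
   exists p : procedure R (set R),
   forall (X : set R) (D : R -> R),
     X !=set0 -> compact X -> polytope X ->
     vertex_bound (nb_vertices X) nf -> is_oracle X D ->
     [/\ queries p D = [:: 1; -1], result p D = X,
         D 1 = - D (-1) -> nb_vertices X = 1%N /\ X = [set D 1] &
         D 1 <> - D (-1) ->
           nb_vertices X = 2%N /\ X = conv_hull [set D 1; - D (-1)] ]).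
Proof.
split=> nfE.
  exists (Ask 1 (fun a => Return [set a])) => X D _ _ pX.
  rewrite nfE /= => nX XD.
  suff XE : X = [set D 1] by split.
  have [DE|DN] := eqVneq (- D (-1)) (D 1).
    by rewrite (oracle_itv pX XD) DE set_itv1.
  have mM : - D (-1) < D 1 by rewrite lt_neqAle DN (oracle_le XD).
  by move: nX; rewrite (oracle_itv pX XD) (nb_vertices_itv mM).
exists (Ask 1 (fun a => Ask (-1) (fun b => Return `[- b, a]%classic))).
move=> X D _ _ pX _ XD; have XE := oracle_itv pX XD.
split=> //= [DE|/eqP DN].
  by rewrite XE -DE nb_vertices_itv1 set_itv1.
have mM : - D (-1) < D 1 by rewrite lt_neqAle eq_sym DN (oracle_le XD).
by rewrite {1}XE (nb_vertices_itv mM) conv_hull2 ?ltW.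
Qed.
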